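(* Consider the block-randomized sampling process described in the context, in which at iteration $t$, given $\mathcal{B}_{(t)}$ and the mode $\xi_{(t)}=n$, the batch is drawn according to $\mathbf{p}\in\mathbb{R}^{J_n}$. Suppose that $\mathbf{p}$ is any probability distribution, and let $\mathbf{R}^{(n)}_{(t)}=\mathbf{A}^{(n)}_{(t)}(\mathbf{Z}^{(n)}_{(t)})^\top-\mathbf{X}_{(n)}$. Then, if $\mathbf{p}$ is given by $$p_i=\frac{\|\mathbf{R}^{(\xi_{(t)})}_{(t)}(:,i)\|_2\,\|\mathbf{Z}^{(\xi_{(t)})}_{(t)}(i,:)\|_2}{\sum_{i'=1}^{J_n}\|\mathbf{R}^{(\xi_{(t)})}_{(t)}(:,i')\|_2\,\|\mathbf{Z}^{(\xi_{(t)})}_{(t)}(i',:)\|_2},\qquad i=1,\dots,J_n,$$ the quantity $$\mathbb{E}_{\zeta_{(t)}}\left[\left\|\mathbf{G}^{(\xi_{(t)})}_{(t)}-\nabla_{\mathbf{A}^{(\xi_{(t)})}}f(\boldsymbol{\theta}_{(t)})\right\|_F^2\;\middle|\;\mathcal{B}_{(t)},\xi_{(t)}\right]$$ achieves its minimum (over probability distributions $\mathbf{p}$), and this minimum is $$\frac1{|\mathcal{F}_n|}\left(\sum_{j=1}^{J_n}\|\mathbf{R}^{(\xi_{(t)})}_{(t)}(:,j)\|_2\,\|\mathbf{Z}^{(\xi_{(t)})}_{(t)}(j,:)\|_2\right)^2-\frac1{|\mathcal{F}_n|}\left\|\nabla_{\mathbf{A}^{(\xi_{(t)})}}f(\bo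ldsymbol{\theta}_{(t)})\right\|_F^2.$$
   Context: A probability distribution on $\{1,\dots,J\}$ is a vector $\mathbf{p}\in[0,1]^J$ with $\sum_{i=1}^J p_i=1$. Let $\mathcal{X}\in\mathbb{R}^{I_1\times\cdots\times I_N}$ be a tensor, let $R$ be a positive integer, and let $\boldsymbol{\theta}=[\mathbf{A}^{(1)},\dots,\mathbf{A}^{(N)}]$ with factor matrices $\mathbf{A}^{(k)}\in\mathbb{R}^{I_k\times R}$. For a mode $n$ put $J_n=\prod_{m\ne n}I_m$. Indices $j\in\{1,\dots,J_n\}$ are in bijection with multi-indices $(i_k)_{k\neq n}$, $1\le i_k\le I_k$, via $j=1+\sum_{k\ne n}(i_k-1)\prod_{m<k,\,m\neq n}I_m$. The mode-$n$ unfolding $\mathbf{X}_{(n)}\in\mathbb{R}^{I_n\times J_n}$ has entry $\mathcal{X}_{i_1,\dots,i_N}$ at position $(i_n,j)$. The Khatri-Rao matrix $\mathbf{Z}^{(n)}=\mathbf{A}^{(N)}\odot\cdots\odot\mathbf{A}^{(n+1)}\odot\mathbf{A}^{(n-1)}\odot\cdots\odot\mathbf{A}^{(1)}\in\mathbb{R}^{J_n\times R}$ has as its $j$-th row the entrywise (Hadamard) product of the rows $\mathbf{A}^{(k)}(i_k,:)$, $k\neq n$; $\mathbf{Z}^{(n)}_{(t)}$ is this matrix computed at the iterate $\boldsymbol{\theta}_{(t)}=[\mathbf{A}^{(1)}_{(t)},\dots,\mathbf{A}^{(N)}_{(t)}]$. For a matrix $\mathbf{M}$, $\mathbf{M}(:,i)$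 and $\mathbf{M}(i,:)$ denote its $i$-th column and $i$-th row. Objective: $f(\boldsymbol{\theta})=\frac12\|\mathcal{X}-\sum_{r=1}^R\mathbf{a}^{(1)}_r\circ\cdots\circ\mathbf{a}^{(N)}_r\|_F^2=\frac12\|\mathbf{Z}^{(n)}(\mathbf{A}^{(n)})^\top-\mathbf{X}_{(n)}^\top\|_F^2$ for each $n$, where $\mathbf{a}^{(k)}_r$ is the $r$-th column of $\mathbf{A}^{(k)}$ and $\circ$ is the outer product. For a given mode $n$, $f=\frac1{J_n}\sum_{j=1}^{J_n}f_j$ with $f_j(\boldsymbol{\theta})=\frac{J_n}{2}\|\mathbf{Z}^{(n)}(j,:)(\mathbf{A}^{(n)})^\top-\mathbf{X}_{(n)}^\top(j,:)\|_F^2$. Process: $\boldsymbol{\theta}_{(0)}$ is given. At iteration $t$, a mode $\xi_{(t)}=n$ is drawn uniformly from $\{1,\dots,N\}$. Then, given the past and $n$, a batch $\zeta_{(t)}=(j_1,\dots,j_{|\mathcal{F}_n|})$ of fixed size $|\mathcal{F}_n|$ is drawn independently, with replacement, from $\{1,\dots,J_n\}$ according to a probability distribution $\mathbf{p}=(p_j)_{j=1}^{J_n}$, which may depend on $\boldsymbol{\theta}_{(t)}$ and $n$. The stochastic gradient is $$\mathbf{G}^{(n)}_{(t)}=\frac{1}{|\mathcal{F}_n|J_n}\sum_{s=1}^{|\mathcal{F}_n|}\frac1{p_{j_s}}\nabla_{\mathbf{A}^{(n)}}f_{j_s}(\boldsymbol{\theta}_{(t)}),$$ and $\boldsymbol{\theta}_{(t+1)}$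 is obtained by $\mathbf{A}^{(n)}_{(t+1)}=\mathbf{A}^{(n)}_{(t)}-\alpha_t\mathbf{G}^{(n)}_{(t)}$ with step size $\alpha_t$, leaving the other factor matrices unchanged. $\mathcal{B}_{(t)}$ is the filtration generated by $\xi_{(0)},\zeta_{(0)},\dots,\xi_{(t-1)},\zeta_{(t-1)}$, so $\boldsymbol{\theta}_{(t)}$ is determined by $\mathcal{B}_{(t)}$. $\mathbb{E}_{\zeta_{(t)}}[\cdot\mid\mathcal{B}_{(t)},\xi_{(t)}]$ denotes conditional expectation over $\zeta_{(t)}$, and in the claim $n=\xi_{(t)}$.
   Formalization: The minimum is taken over distributions p with p_j=0 only where the gradient of f_j in A^(n) vanishes; over all p it is false: |F|=1, J=2, orthonormal g_j=∇f_j/J, p=(1,0) gives error 1, below the claimed 2. The displayed p is treated only when its denominator is nonzero. *)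

(* Defs.v *)
From HB Require Import structures.
From mathcomp Require Import all_boot all_order all_algebra.
From mathcomp Require Import all_classical all_reals all_analysis.

Set Implicit Arguments.
Unset Strict Implicit.
Unset Printing Implicit Defensive.

Import Order.TTheory GRing.Theory Num.Theory.
Import numFieldNormedType.Exports.
Local Open Scope classical_set_scope.
Local Open Scope ring_scope.

Section Factorization.
Variables (R : realType) (N : nat) (I : 'I_N -> nat) (rk : nat).

(* Modes and tensor positions are numbered from 0. *)
Definition mindex := {dffun forall k : 'I_N, 'I_(I k)}.
Definition tensor := {ffun mindex -> R}.
Definition factors := forall k : 'I_N, 'M[R]_(I k, rk).

Definition ncols (n : 'I_N) : nat := (\prod_(m : 'I_N | m != n) I m)%N.

(* The 0-based form of j = 1 + \sum_(k <> n) (i_k - 1) \prod_(m < k, m <> n) I_m;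
   the n-th component of i is ignored. *)
Definition col_index (n : 'I_N) (i : mindex) : nat :=
  (\sum_(k : 'I_N | k != n) i k * \prod_(m : 'I_N | (m < k) && (m != n)) I m)%N.

(* When all the dimensions are positive, such an i always exists and is unique
   up to its n-th component, which the two definitions below do not use. *)
Definition mindex_of (n : 'I_N) (j : 'I_(ncols n)) : option mindex :=
  [pick i | col_index n i == j].

Definition unfolding (X : tensor) (n : 'I_N) : 'M[R]_(I n, ncols n) :=
  \matrix_(a < I n, j < ncols n)
    if mindex_of j is Some i then X [ffun k => dfwith i n a k] else 0.

Definition khatri_rao (theta : factors) (n : 'I_N) : 'M[R]_(ncols n, rk) :=
  \matrix_(j < ncols n, l < rk)
    if mindex_of j is Some i then \prod_(k : 'I_N | k != n) theta k (i k) l else 0.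

(* Frobenius norm, which on a single row or column is the Euclidean norm; the
   norm `|M| of the library is the maximum norm. *)
Definition fnorm (a b : nat) (M : 'M[R]_(a, b)) : R :=
  Num.sqrt (\sum_i \sum_j M i j ^+ 2).

Definition objective (X : tensor) (theta : factors) : R :=
  2^-1 * \sum_(i : mindex)
           (X i - \sum_(l < rk) \prod_(k : 'I_N) theta k (i k) l) ^+ 2.

Definition component (X : tensor) (n : 'I_N) (j : 'I_(ncols n))
    (theta : factors) : R :=
  (ncols n)%:R / 2
  * fnorm (row j (khatri_rao theta n) *m (theta n)^T
           - row j (unfolding X n)^T) ^+ 2.

(* The matrix of the partial derivatives of g with respect to the entries of
   the n-th factor. *)
Definition grad (n : 'I_N) (g : factors -> R) (theta : factors) :
    'M[R]_(I n, rk) :=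
  \matrix_(a < I n, l < rk)
    derive1 (fun s : R => g (dfwith theta n (theta n + s *: delta_mx a l))) 0.

Definition residual (X : tensor) (theta : factors) (n : 'I_N) :
    'M[R]_(I n, ncols n) :=
  theta n *m (khatri_rao theta n)^T - unfolding X n.

Definition weight (X : tensor) (theta : factors) (n : 'I_N)
    (j : 'I_(ncols n)) : R :=
  fnorm (col j (residual X theta n)) * fnorm (row j (khatri_rao theta n)).

Definition opt_distr (X : tensor) (theta : factors) (n : 'I_N)
    (j : 'I_(ncols n)) : R :=
  @weight X theta n j / \sum_j' @weight X theta n j'.

End Factorization.

Arguments weight {R N I rk} X theta n j.
Arguments opt_distr {R N I rk} X theta n j.

Definition prob_distr (R : realType) (J : nat) (p : 'I_J -> R) : Prop :=
  (forall j, 0 <= p j <= 1) /\ \sum_j p j = 1.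

Section Sampling.
Variables (R : realType) (N : nat) (I : 'I_N -> nat) (rk : nat).
Variables (X : tensor R I) (F : 'I_N -> nat).

(* An index has probability zero only if its gradient is zero, so that the
   importance weights 1 / p_j make sense wherever they matter. A distribution
   without this property gives a biased stochastic gradient, whose expected
   squared error can be smaller than that of every distribution with it. *)
Definition supports_gradients (theta : factors R I rk) (n : 'I_N)
    (p : 'I_(ncols I n) -> R) : Prop :=
  forall j, p j = 0 -> grad n (component X j) theta = 0.

Definition stoch_grad (theta : factors R I rk) (n : 'I_N)
    (p : 'I_(ncols I n) -> R) (z : (F n).-tuple 'I_(ncols I n)) :
    'M[R]_(I n, rk) :=
  ((F n)%:R * (ncols I n)%:R)^-1
  *: \sum_(s < F n) (p (tnth z s))^-1 *: grad n (component X (tnth z s)) theta.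

(* The mode and the batch drawn in one iteration. *)
Definition draw := {n : 'I_N & (F n).-tuple 'I_(ncols I n)}.

(* The distribution used at a given iteration, iterate and mode. *)
Definition sampling_rule :=
  nat -> factors R I rk -> forall n : 'I_N, 'I_(ncols I n) -> R.

Fixpoint iterate (theta0 : factors R I rk) (alpha : nat -> R)
    (p : sampling_rule) (w : nat -> draw) (t : nat) : factors R I rk :=
  if t is s.+1 then
    let theta := iterate theta0 alpha p w s in
    let n := tag (w s) in
    dfwith theta n
      (theta n - alpha s *: stoch_grad theta (p s theta n) (tagged (w s)))
  else theta0.

End Sampling.

Section Process.
Variables (R : realType) (N : nat) (I : 'I_N -> nat) (rk : nat).
Variables (d : measure_display) (T : measurableType d).
Variables (X : tensor R I) (F : 'I_N -> nat).
Variables (theta0 : factors R I rk) (alpha : nat -> R).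
Variables (p : sampling_rule R I rk).
Variables (P : probability T R) (W : T -> nat -> draw I F).

Definition past (w : nat -> draw I F) (t : nat) : set T :=
  [set omega | forall s, (s < t)%N -> W omega s = w s].

(* The conditional laws of the mode given the past, and of the batch given the
   past and the mode, multiplied out so as to allow conditions of probability
   zero. *)
Definition sampling_process : Prop :=
  [/\ forall t x, measurable [set omega | W omega t = x],
      forall t (w : nat -> draw I F) (n : 'I_N),
        P (past w t `&` [set omega | tag (W omega t) = n])
        = (P (past w t) * (N%:R^-1)%:E)%E
    & forall t (w : nat -> draw I F) (n : 'I_N)
             (z : (F n).-tuple 'I_(ncols I n)),
        P (past w t `&` [set omega | W omega t = Tagged _ z])
        = (P (past w t `&` [set omega | tag (W omega t) = n])
           * (\prod_(s < F n)
                @p t (iterate X theta0 alpha p w t) n (tnth z s))%:E)%E].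

(* The sigma-algebra generated by the draws before iteration t and by the mode
   drawn at iteration t. *)
Definition past_and_mode (t : nat) : set_system T :=
  <<s [set A | exists2 s, (s < t)%N & exists x, A = [set omega | W omega s = x]]
      `|` [set A | exists n, A = [set omega | tag (W omega t) = n]] >>.

End Process.

Section ConditionalExpectation.
Variables (R : realType) (d : measure_display) (T : measurableType d).
Variables (P : probability T R) (G : set_system T) (Y : T -> R).

Definition cond_exp_version (Z : T -> R) : Prop :=
  [/\ forall B : set R, measurable B -> G (Z @^-1` B),
      P.-integrable setT (EFin \o Z)
    & forall A, G A ->
        (\int[P]_(omega in A) (Z omega)%:E = \int[P]_(omega in A) (Y omega)%:E)%E].

(* Some version of E[Y | G] if there is one, the zero function otherwise. *)
Definition cond_exp : T -> R := xget (cst 0) [set Z | cond_exp_version Z].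

End ConditionalExpectation.

(* Main.v *)
(** In the mode [n] with residual matrix [R] and Khatri-Rao matrix [Z], the
    gradient of the component [f_j] is [J_n R(:,j) Z(j,:)], so its Frobenius
    norm is [J_n] times the weight [w_j]. When every index whose gradient is
    nonzero has positive probability, the stochastic gradient is an average of
    independent unbiased estimators of the gradient of [f], and its expected
    squared error is [(\sum_j w_j^2 / p_j - |grad f|^2) / |F_n|]. By
    Cauchy-Schwarz [\sum_j w_j^2 / p_j >= (\sum_j w_j)^2], with equality when
    [p] is proportional to [w].

    The draws take finitely many values, so the conditional expectation is an
    average over each set on which the past and the mode are constant, except
    on the finite union of those that have probability zero. *)

Require Import Defs.
From HB Require Import structures.
From mathcomp Require Import all_boot all_order all_algebra.
From mathcomp Require Import all_classical all_reals all_analysis.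
From mathcomp Require Import ring.

Set Implicit Arguments.
Unset Strict Implicit.
Unset Printing Implicit Defensive.

Import Order.TTheory GRing.Theory Num.Theory.
Import numFieldNormedType.Exports.
Local Open Scope classical_set_scope.
Local Open Scope ring_scope.

(** * Conditional expectation given a finite-valued map *)

Section FiniteFibers.
Variables (R : realType) (d : measure_display) (T : measurableType d).
Variables (P : probability T R).

Lemma measurable_preimage_fin (K : finType) (h : T -> K) (B : set K) :
  (forall k, measurable (h @^-1` [set k])) -> measurable (h @^-1` B).
Proof.
move=> mh.
have -> : h @^-1` B = \bigcup_(k in B) (h @^-1` [set k]).
  by apply/seteqP; split=> [x Bx|x [k Bk /= ->//]]; exists (h x).
by apply: fin_bigcup_measurable => // k _; exact: mh.
Qed.

Lemma measurable_fun_fin (K : finType) (h : T -> K) (D : set T) (y : K -> R) :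
  (forall k, measurable (h @^-1` [set k])) ->
  measurable_fun D (fun x => y (h x)).
Proof.
move=> mh mD B mB; apply: measurableI => //.
exact: (measurable_preimage_fin (y @^-1` B) mh).
Qed.

Lemma integrable_fin (K : finType) (h : T -> K) (y : K -> R) :
  (forall k, measurable (h @^-1` [set k])) ->
  P.-integrable setT (EFin \o (fun x => y (h x))).
Proof.
move=> mh; apply: measurable_bounded_integrable => //.
- by rewrite -ge0_fin_numE // fin_num_measure.
- exact: measurable_fun_fin.
- exists (\sum_k `|y k|); split; first exact: num_real.
  move=> M ltM x _ /=; apply: le_trans (ltW ltM).
  by rewrite (bigD1 (h x)) //= lerDl sumr_ge0.
Qed.

Lemma integral_fibers (K : finType) (h : T -> K) (A : set T) (f : T -> R) :
  (forall k, measurable (h @^-1` [set k])) -> measurable A ->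
  measurable_fun setT f -> (forall x, 0 <= f x) ->
  (\int[P]_(x in A) (f x)%:E
   = \sum_k \int[P]_(x in A `&` h @^-1` [set k]) (f x)%:E)%E.
Proof.
move=> mh mA mf f0.
have eqA : A = \big[setU/set0]_(k <- index_enum K) (A `&` h @^-1` [set k]).
  rewrite -bigcup_seq; apply/seteqP; split=> [x Ax|x [k _ []//]].
  by exists (h x) => //=; rewrite mem_index_enum.
rewrite [in LHS]eqA ge0_integral_bigsetU //.
- by move=> k; apply: measurableI.
- exact: index_enum_uniq.
- by move=> i j _ _ [x [[_ /= <-] [_ /= <-]]].
- by rewrite -eqA; apply/measurable_realfun.measurable_EFinP; apply: measurable_funS mf.
- by move=> x _; rewrite lee_fin.
Qed.

Lemma integral_fin (K : finType) (h : T -> K) (A : set T) (y : K -> R) :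
  (forall k, measurable (h @^-1` [set k])) -> measurable A ->
  (forall k, 0 <= y k) ->
  (\int[P]_(x in A) (y (h x))%:E
   = \sum_k (y k)%:E * P (A `&` h @^-1` [set k]))%E.
Proof.
move=> mh mA y0; rewrite (integral_fibers mh mA) //; last exact: measurable_fun_fin.
apply: eq_bigr => k _; rewrite -integral_cst; last by apply: measurableI.
by apply: eq_integral => x; rewrite inE => -[_ /= ->].
Qed.

Variables (G : set_system T) (K : finType) (h : T -> K).
Hypothesis mh : forall k, measurable (h @^-1` [set k]).
(** Since [K] is finite, this makes [G] the sigma-algebra generated by [h]. *)
Hypothesis Gh : forall A, G A <-> exists B : set K, A = h @^-1` B.

(** The version is obtained by averaging [Y] over each fiber of [h]. *)
Lemma cond_exp_version_fin (Y : T -> R) :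
  P.-integrable setT (EFin \o Y) -> (forall x, 0 <= Y x) ->
  exists Z : T -> R, cond_exp_version P G Y Z.
Proof.
move=> iY Y0.
have mY : measurable_fun setT Y.
  by apply/measurable_realfun.measurable_EFinP; apply: measurable_int iY.
have Pfin A : measurable A -> P A \is a fin_num by move=> mA; exact: fin_num_measure.
have iYA A : measurable A -> P.-integrable A (EFin \o Y).
  by move=> mA; apply: integrableS iY.
pose z k := fine (\int[P]_(x in h @^-1` [set k]) (Y x)%:E)%E
            / fine (P (h @^-1` [set k])).
have z0 k : 0 <= z k.
  rewrite divr_ge0 ?fine_ge0 //.
  by apply: integral_ge0 => x _; rewrite lee_fin.
exists (fun x => z (h x)); split.
- by move=> B _; apply/Gh; exists (z @^-1` B).
- exact: integrable_fin.
move=> A /Gh[B ->].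
have mA := measurable_preimage_fin B mh.
rewrite (integral_fibers mh mA) //; last exact: measurable_fun_fin.
rewrite [RHS](integral_fibers mh mA) //.
apply: eq_bigr => k _.
have [Bk|nBk] := pselect (B k); last first.
  suff -> : h @^-1` B `&` h @^-1` [set k] = set0 by rewrite !integral_set0.
  by apply/seteqP; split=> x //= [Bx hx]; apply: nBk; rewrite -hx.
have -> : h @^-1` B `&` h @^-1` [set k] = h @^-1` [set k].
  by apply/seteqP; split=> x /= => [[]//|hx]; rewrite hx.
transitivity ((z k)%:E * P (h @^-1` [set k]))%E.
  rewrite -integral_cst //; apply: eq_integral => x.
  by rewrite inE => /= ->.
(* On a null fiber both integrals vanish, whatever value the division by zero gives to [z k]. *)
have [P0|Pn0] := eqVneq (P (h @^-1` [set k])) 0%E.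
  rewrite P0 mule0; symmetry; apply: null_set_integral => //.
  exact: measurable_int (iYA _ (mh k)).
have fP0 : fine (P (h @^-1` [set k])) != 0 by rewrite fine_eq0 ?Pfin.
rewrite -[X in (_ * X)%E]fineK ?Pfin // -EFinM /z mulfVK // fineK //.
exact: (integrable_fin_num _ (iYA _ _)).
Qed.

(** Whichever version [xget] picks, it is constant on each fiber, so its integral there is its value
    times the mass. The product form covers null fibers too. *)
Lemma cond_exp_fiber (Y : T -> R) (w : T) :
  P.-integrable setT (EFin \o Y) -> (forall x, 0 <= Y x) ->
  ((cond_exp P G Y w)%:E * P (h @^-1` [set h w])
   = \int[P]_(x in h @^-1` [set h w]) (Y x)%:E)%E.
Proof.
move=> iY Y0; have [Z vZ] := cond_exp_version_fin iY Y0.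
have := @xgetPex _ (cst 0) [set Z | cond_exp_version P G Y Z] (ex_intro _ Z vZ).
rewrite -/(cond_exp P G Y); set C := cond_exp P G Y => -[GC _ intC].
rewrite -intC; last by apply/Gh; exists [set h w].
rewrite -integral_cst //; apply: eq_integral => x; rewrite inE /= => hx.
congr EFin.
(* The level set of [C] through [w] is a preimage under [h], so it contains the whole fiber of
   [w]. *)
have /Gh[B eqB] := GC [set C w] (measurable_set1 _).
have : (C @^-1` [set C w]) x by rewrite eqB /= hx -[B (h w)]/((h @^-1` B) w) -eqB.
by move=> /= ->.
Qed.

(** The exceptional set is a finite union of null fibers. *)
Lemma ae_fiber_neq0 : {ae P, forall w, P (h @^-1` [set h w]) != 0%E}.
Proof.
pose B := [set k | P (h @^-1` [set k]) = 0%E].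
exists (h @^-1` B); split.
- exact: measurable_preimage_fin.
- have -> : h @^-1` B = \bigcup_(k in B) (h @^-1` [set k]).
    by apply/seteqP; split=> [x Bx|x [k Bk /= ->//]]; exists (h x).
  rewrite measure_fin_bigcup; first (by apply: fsbig1 => k); first exact: finite_finset.
    by move=> i j _ _ [x [/= <- <-]].
  by move=> k _; exact: mh.
- by move=> x /= /negP; rewrite negbK => /eqP.
Qed.

End FiniteFibers.

(** * Variance of the mean of an independent batch *)

Section IndependentBatch.
Variables (R : realType) (K : finType) (m : nat) (q : K -> R).
Hypothesis q1 : \sum_j q j = 1.

(** Distributivity, used as the factorization of expectations over independent slots. *)
Lemma sum_tuple_prod (h : 'I_m -> K -> R) :
  \sum_(z : m.-tuple K) \prod_(s < m) h s (tnth z s) = \prod_(s < m) \sum_j h s j.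
Proof.
rewrite bigA_distr_bigA (reindex (@tuple_of_finfun K m)); last first.
  exists (@finfun_of_tuple K m) => z _.
    exact: tuple_of_finfunK.
  exact: finfun_of_tupleK.
apply: eq_bigr => f _; apply: eq_bigr => s _.
by rewrite tnth_mktuple.
Qed.

(** Each slot other than [s] sums to 1, so the marginal law of slot [s] is [q]. *)
Lemma batch_mean1 (x : K -> R) (s : 'I_m) :
  \sum_(z : m.-tuple K) (\prod_(i < m) q (tnth z i)) * x (tnth z s)
  = \sum_j q j * x j.
Proof.
pose h i j := q j * (if i == s then x j else 1).
have -> : \sum_j q j * x j = \prod_(i < m) \sum_j h i j.
  rewrite (bigD1 s) //= [X in _ * X]big1 ?mulr1 => [|i /negPf nis].
    by apply: eq_bigr => j _; rewrite /h eqxx.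
  by rewrite -[RHS]q1; apply: eq_bigr => j _; rewrite /h nis mulr1.
rewrite -sum_tuple_prod; apply: eq_bigr => z _.
rewrite big_split /=; congr (_ * _).
by rewrite -big_mkcond /= big_pred1_eq.
Qed.

(** The expectation factors over the slots, and the factor of slot [s] is the mean of [x]. *)
Lemma batch_cross (x : K -> R) (s r : 'I_m) : s != r ->
  \sum_j q j * x j = 0 ->
  \sum_(z : m.-tuple K)
     (\prod_(i < m) q (tnth z i)) * (x (tnth z s) * x (tnth z r)) = 0.
Proof.
move=> sr x0.
pose h i j := q j * ((if i == s then x j else 1) * (if i == r then x j else 1)).
transitivity (\prod_(i < m) \sum_j h i j); last first.
  rewrite (bigD1 s) //= (_ : \sum_j h s j = 0) ?mul0r //.
  by rewrite -[RHS]x0; apply: eq_bigr => j _; rewrite /h eqxx (negPf sr) mulr1.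
rewrite -sum_tuple_prod; apply: eq_bigr => z _.
rewrite !big_split /=; congr (_ * (_ * _)).
  by rewrite -big_mkcond /= big_pred1_eq.
by rewrite -big_mkcond /= big_pred1_eq.
Qed.

(** When the square is expanded, only the [m] diagonal terms survive. *)
Lemma batch_sum_sqr (x : K -> R) : \sum_j q j * x j = 0 ->
  \sum_(z : m.-tuple K)
     (\prod_(s < m) q (tnth z s)) * (\sum_(s < m) x (tnth z s)) ^+ 2
  = m%:R * \sum_j q j * x j ^+ 2.
Proof.
move=> x0.
transitivity (\sum_(s < m) \sum_(r < m) \sum_(z : m.-tuple K)
    (\prod_(i < m) q (tnth z i)) * (x (tnth z s) * x (tnth z r))).
  rewrite (eq_bigr (fun s => \sum_(z : m.-tuple K) \sum_(r < m)
    (\prod_(i < m) q (tnth z i)) * (x (tnth z s) * x (tnth z r)))); last first.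
    by move=> s _; rewrite exchange_big.
  rewrite exchange_big; apply: eq_bigr => z _ /=.
  rewrite expr2 mulr_suml mulr_sumr; apply: eq_bigr => s _.
  by rewrite !mulr_sumr.
transitivity (\sum_(s < m) \sum_j q j * x j ^+ 2); last first.
  by rewrite sumr_const card_ord mulr_natl.
apply: eq_bigr => s _.
rewrite (bigD1 s) //= [X in _ + X]big1 ?addr0.
  by rewrite -(batch_mean1 (fun j => x j ^+ 2) s).
by move=> r rs; rewrite batch_cross // eq_sym.
Qed.

Lemma batch_variance (e : K -> R) : (0 < m)%N ->
  \sum_(z : m.-tuple K) (\prod_(s < m) q (tnth z s))
     * (m%:R^-1 * (\sum_(s < m) e (tnth z s)) - \sum_j q j * e j) ^+ 2
  = m%:R^-1 * (\sum_j q j * e j ^+ 2 - (\sum_j q j * e j) ^+ 2).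
Proof.
move=> m_gt0; set g := \sum_j q j * e j.
have m0 : m%:R != 0 :> R by rewrite pnatr_eq0 -lt0n.
(* Centering [e] at its mean makes [batch_sum_sqr] applicable. *)
pose x j := e j - g.
have x0 : \sum_j q j * x j = 0.
  under eq_bigr do rewrite mulrBr.
  by rewrite sumrB -mulr_suml q1 mul1r subrr.
transitivity (m%:R^-1 ^+ 2 * \sum_(z : m.-tuple K)
     (\prod_(s < m) q (tnth z s)) * (\sum_(s < m) x (tnth z s)) ^+ 2).
  rewrite mulr_sumr; apply: eq_bigr => z _.
  rewrite [RHS]mulrCA -exprMn; congr (_ * _ ^+ 2).
  by rewrite sumrB sumr_const card_ord -(mulr_natl g m) mulrBr mulKf.
rewrite (batch_sum_sqr x0) expr2 -mulrA mulKf //; congr (_ * _).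
transitivity (\sum_j (q j * e j ^+ 2 - (q j * e j) * (g + g) + q j * g ^+ 2)).
  by apply: eq_bigr => j _; rewrite /x; ring.
by rewrite big_split sumrB -!mulr_suml q1 -/g /=; ring.
Qed.

End IndependentBatch.

(** * Mixed radix numbering of the columns *)

Section MixedRadix.
Implicit Types (b d : nat -> nat).

(** The least significant digit comes first. Bases and digits are total functions on [nat], so that
    induction on the number of digits needs no dependent types. *)
Definition mixed_radix b d m := (\sum_(k < m) d k * \prod_(q < k) b q)%N.

Lemma mixed_radixS b d m :
  mixed_radix b d m.+1 = (mixed_radix b d m + d m * \prod_(q < m) b q)%N.
Proof. by rewrite /mixed_radix big_ord_recr. Qed.

Lemma mixed_radix_lt b d m : (forall k, (k < m)%N -> (d k < b k)%N) ->
  (mixed_radix b d m < \prod_(q < m) b q)%N.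
Proof.
elim: m => [|m IHm] lt_db; first by rewrite /mixed_radix !big_ord0.
rewrite mixed_radixS big_ord_recr /=.
apply: (@leq_trans ((d m).+1 * \prod_(q < m) b q)); last first.
  by rewrite mulnC leq_mul2l lt_db ?orbT.
by rewrite mulSn ltn_add2r IHm // => k km; apply: lt_db; apply: leqW.
Qed.

(** Division by the product of the lower bases recovers the leading digit; cancelling it leaves the
    induction hypothesis. *)
Lemma mixed_radix_inj b d d' m :
  (forall k, (k < m)%N -> (d k < b k)%N) ->
  (forall k, (k < m)%N -> (d' k < b k)%N) ->
  mixed_radix b d m = mixed_radix b d' m ->
  forall k, (k < m)%N -> d k = d' k.
Proof.
elim: m => // m IHm lt_db lt_d'b; rewrite !mixed_radixS => eq_dd'.
have ltd : (mixed_radix b d m < \prod_(q < m) b q)%N.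
  by apply: mixed_radix_lt => k km; apply: lt_db; apply: leqW.
have ltd' : (mixed_radix b d' m < \prod_(q < m) b q)%N.
  by apply: mixed_radix_lt => k km; apply: lt_d'b; apply: leqW.
have B0 : (0 < \prod_(q < m) b q)%N by apply: leq_ltn_trans ltd.
have eqm : d m = d' m.
  move/(congr1 (divn^~ (\prod_(q < m) b q)%N)): eq_dd'.
  by rewrite !divnDMl // !divn_small.
move=> k; rewrite ltnS leq_eqVlt => /predU1P[->//|km].
apply: IHm km => [k' km'|k' km'|]; [exact/lt_db/leqW|exact/lt_d'b/leqW|].
by move: eq_dd'; rewrite eqm => /addIn.
Qed.

Lemma mixed_radix_surj b m j : (j < \prod_(q < m) b q)%N ->
  exists2 d, forall k, (k < m)%N -> (d k < b k)%N & mixed_radix b d m = j.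
Proof.
elim: m j => [|m IHm] j.
  rewrite big_ord0 ltnS leqn0 => /eqP->; exists (fun=> 0%N) => //.
  by rewrite /mixed_radix big_ord0.
rewrite big_ord_recr /=; set B := (\prod_(q < m) b q)%N => ltj.
have B0 : (0 < B)%N by case: B ltj => //; rewrite mul0n.
have [d lt_db dj] := IHm _ (ltn_pmod j B0).
(* The leading digit is the quotient by [B]; the others expand the remainder. *)
exists (fun k => if k == m then j %/ B else d k)%N.
  move=> k; case: eqP => [->|/eqP nkm]; first by rewrite ltn_divLR // mulnC.
  by rewrite ltnS leq_eqVlt (negPf nkm); apply: lt_db.
rewrite mixed_radixS eqxx [RHS](divn_eq j B) addnC -dj; congr (_ + _)%N.
by apply: eq_bigr => k _; rewrite (ltn_eqF (ltn_ord k)).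
Qed.

End MixedRadix.

(** * Columns of the unfolding and multi-indices *)

Section ColumnIndex.
Variables (N : nat) (I : 'I_N -> nat) (n : 'I_N).
Implicit Types i : mindex I.

(* Giving the mode n the base 1 turns the enumeration of the columns into a
   mixed radix expansion over all the modes. *)
Let base (q : nat) : nat :=
  if insub q is Some m then if m == n then 1%N else I m else 1%N.

(** In base 1 the only digit is 0, so the mode [n] contributes nothing. *)
Let digit i (q : nat) : nat :=
  if insub q is Some m then if m == n then 0%N else i m : nat else 0%N.

Let baseE (m : 'I_N) : base m = if m == n then 1%N else I m.
Proof. by rewrite /base valK. Qed.

Let digitE i (m : 'I_N) : digit i m = if m == n then 0%N else i m : nat.
Proof. by rewrite /digit valK. Qed.

Let digit_lt i q : (q < N)%N -> (digit i q < base q)%N.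
Proof.
move=> qN; rewrite -[q]/(val (Ordinal qN)) digitE baseE.
by case: ifP => // _; apply: ltn_ord.
Qed.

Let ncolsE : ncols I n = (\prod_(q < N) base q)%N.
Proof.
rewrite /ncols big_mkcond /=; apply: eq_bigr => m _.
by rewrite baseE; case: eqP.
Qed.

Let col_indexE i : col_index n i = mixed_radix base (digit i) N.
Proof.
rewrite /col_index big_mkcond; apply: eq_bigr => k _ /=.
rewrite digitE; case: (eqVneq k n) => //= _; congr (_ * _)%N.
rewrite (big_ord_widen _ base (ltnW (ltn_ord k))) big_mkcondr /=.
by apply: eq_bigr => m _; rewrite baseE; case: eqP.
Qed.

Lemma col_index_lt i : (col_index n i < ncols I n)%N.
Proof. by rewrite col_indexE ncolsE mixed_radix_lt // => q; apply: digit_lt. Qed.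

Lemma col_index_inj i i' (k : 'I_N) : col_index n i = col_index n i' ->
  k != n -> i k = i' k.
Proof.
rewrite !col_indexE => /mixed_radix_inj eqd nkn; apply: val_inj => /=.
have := eqd (@digit_lt i) (@digit_lt i') k (ltn_ord k).
by rewrite !digitE (negPf nkn).
Qed.

Lemma col_index_eq i i' : (forall k, k != n -> i k = i' k) ->
  col_index n i = col_index n i'.
Proof. by move=> ii'; apply: eq_bigr => k nkn; rewrite ii'. Qed.

(** The mixed radix digits of [j] supply the components other than [n]; component [n] is set to 0,
    which is where [I n] must be positive. *)
Lemma mindex_of_spec (j : 'I_(ncols I n)) : (0 < I n)%N ->
  exists2 i, mindex_of j = Some i & col_index n i = j.
Proof.
move=> In_gt0; rewrite /mindex_of; case: pickP => [i /eqP ij|none].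
  by exists i.
have := ltn_ord j; rewrite {2}ncolsE => /mixed_radix_surj[d dlt dj].
have dI (k : 'I_N) : ((if k == n then 0 else d k) < I k)%N.
  by case: eqP => [->//|/eqP nkn]; have := dlt k (ltn_ord k); rewrite baseE (negPf nkn).
pose i : mindex I := [ffun k => Ordinal (dI k)].
have /eqP[] := none i; rewrite col_indexE -dj.
apply: eq_bigr => k _; rewrite digitE /i ffunE /=; case: eqVneq => // kn.
by have := dlt k (ltn_ord k); rewrite baseE kn eqxx ltnS leqn0 => /eqP->.
Qed.

(** The position in the tensor that [unfolding] reads for row [a]. *)
Definition place (i : mindex I) (a : 'I_(I n)) : mindex I :=
  [ffun k => dfwith i n a k].

(** Sending [i] to the pair of [i n] and its column index is a bijection, with inverse given by
    [place]. *)
Lemma sum_mindex (R : realType) (g : mindex I -> R) : (0 < I n)%N ->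
  \sum_i g i
  = \sum_(a < I n) \sum_(j < ncols I n)
      if mindex_of j is Some i then g (place i a) else 0.
Proof.
move=> In_gt0; rewrite pair_bigA /=.
rewrite [LHS](partition_big (fun i => (i n, Ordinal (col_index_lt i))) xpredT) //=.
apply: eq_bigr => -[a j] _ /=.
have [i -> ij] := mindex_of_spec j In_gt0.
rewrite (big_pred1 (place i a)) // => i' /=; apply/eqP/eqP => [[i'n i'j]|->].
  apply/ffunP => k; rewrite ffunE; case: dfwithP => // k' nk.
  by apply: col_index_inj; rewrite 1?eq_sym // ij -i'j.
congr (_, _); first by rewrite ffunE dfwithin.
apply: val_inj; rewrite /= -ij; apply: col_index_eq => k nkn.
by rewrite ffunE dfwithout // eq_sym.
Qed.

End ColumnIndex.

(** * Gradients and the mean squared error of a batch *)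

Section Gradients.
Variable R : realType.

Lemma derive1_quadratic (a b c : R) :
  derive1 (fun s : R => a + b * s + c * s ^+ 2) 0 = b.
Proof.
have -> : (fun s : R => a + b * s + c * s ^+ 2)
    = cst a + cst b * id + cst c * id ^+ 2 by apply/funext.
rewrite derive1E; have d0 (r : R) := is_derive_cst r (0 : R) (1 : R).
have d1 := is_derive_id (0 : R) (1 : R).
have d2 := is_deriveM (d0 c) (is_deriveX 2 d1).
rewrite (@derive_val _ _ _ _ _ _ _
  (is_deriveD (is_deriveD (d0 a) (is_deriveM (d0 b) d1)) d2)).
by rewrite /= !scaler0 /GRing.scale /=; ring.
Qed.

(** Along a single entry of one factor, the objective and its components are both sums of squares of
    affine functions, so this yields both gradients. *)
Lemma derive1_sum_sqr (K : finType) (c : R) (u v : K -> R) :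
  derive1 (fun s : R => c * \sum_k (u k + s * v k) ^+ 2) 0
  = c * 2 * \sum_k u k * v k.
Proof.
rewrite -[RHS](derive1_quadratic (c * \sum_k u k ^+ 2) _ (c * \sum_k v k ^+ 2)).
congr (derive1 _ _); apply/funext => s.
have -> : \sum_k (u k + s * v k) ^+ 2
    = \sum_k u k ^+ 2 + s * 2 * (\sum_k u k * v k) + s ^+ 2 * \sum_k v k ^+ 2.
  rewrite !mulr_sumr -!big_split /=; apply: eq_bigr => k _; ring.
by ring.
Qed.

Lemma fnorm_sqr (a b : nat) (M : 'M[R]_(a, b)) :
  fnorm M ^+ 2 = \sum_i \sum_j M i j ^+ 2.
Proof.
by rewrite sqr_sqrtr //; apply: sumr_ge0 => i _; apply: sumr_ge0 => j _; exact: sqr_ge0.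
Qed.

Lemma fnorm_ge0 (a b : nat) (M : 'M[R]_(a, b)) : 0 <= fnorm M.
Proof. exact: sqrtr_ge0. Qed.

Variables (N : nat) (I : 'I_N -> nat) (rk : nat).
Variables (X : tensor R I) (theta : factors R I rk) (n : 'I_N).

(** The product omits factor [n]; hence the residual is affine in that factor. *)
Lemma khatri_rao_update (A : 'M[R]_(I n, rk)) :
  khatri_rao (dfwith theta n A) n = khatri_rao theta n.
Proof.
apply/matrixP => j l; rewrite !mxE; case: mindex_of => // i.
by apply: eq_bigr => k nkn; rewrite dfwithout // eq_sym.
Qed.

Lemma residual_update (A : 'M[R]_(I n, rk)) :
  residual X (dfwith theta n A) n = A *m (khatri_rao theta n)^T - unfolding X n.
Proof. by rewrite /residual khatri_rao_update dfwithin. Qed.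

Lemma residual_shift (s : R) a l b j :
  residual X (dfwith theta n (theta n + s *: delta_mx a l)) n b j
  = residual X theta n b j + s * ((b == a)%:R * khatri_rao theta n j l).
Proof.
set Z := khatri_rao theta n.
have delta_mul : (delta_mx a l *m Z^T) b j = (b == a)%:R * Z j l.
  rewrite !mxE (bigD1 l) //= big1 ?addr0; last first.
    by move=> l' /negPf ll'; rewrite !mxE ll' andbF mul0r.
  by rewrite !mxE eqxx andbT.
rewrite residual_update mulmxDl -scalemxAl -delta_mul /residual.
move: (theta n *m Z^T) (delta_mx a l *m Z^T) (unfolding X n) => P Q U.
by rewrite !mxE addrAC.
Qed.

Lemma component_residual (th : factors R I rk) (j : 'I_(ncols I n)) :
  component X j th = (ncols I n)%:R / 2 * \sum_b residual X th n b j ^+ 2.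
Proof.
rewrite /component fnorm_sqr big_ord1; congr (_ * _).
apply: eq_bigr => b _; rewrite /residual !mxE; congr ((_ - _) ^+ 2).
by apply: eq_bigr => l _; rewrite !mxE mulrC.
Qed.

(** Up to sign, the residual entries are the approximation errors of the tensor entries, rearranged
    by [sum_mindex]. *)
Lemma objective_residual (th : factors R I rk) : (0 < I n)%N ->
  objective X th = 2^-1 * \sum_(bj : 'I_(I n) * 'I_(ncols I n))
                            residual X th n bj.1 bj.2 ^+ 2.
Proof.
move=> In_gt0; rewrite /objective (sum_mindex _ In_gt0); congr (_ * _).
rewrite -(pair_bigA _ (fun b j => residual X th n b j ^+ 2)) /=.
apply: eq_bigr => b _; apply: eq_bigr => j _.
rewrite /residual !mxE.
have [i ij _] := mindex_of_spec j In_gt0; rewrite ij -sqrrN opprB.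
congr ((_ - _) ^+ 2); apply: eq_bigr => l _.
rewrite (bigD1 n) //= ffunE dfwithin !mxE ij; congr (_ * _).
by apply: eq_bigr => k nkn; rewrite ffunE dfwithout // eq_sym.
Qed.

Lemma sum_delta (K : finType) (a : K) (f : K -> R) :
  \sum_b f b * (b == a)%:R = f a.
Proof.
rewrite (bigD1 a) //= eqxx mulr1 big1 ?addr0 // => b /negPf->.
by rewrite mulr0.
Qed.

Lemma grad_component (j : 'I_(ncols I n)) a l :
  grad n (component X j) theta a l
  = (ncols I n)%:R * (residual X theta n a j * khatri_rao theta n j l).
Proof.
rewrite mxE; under eq_fun => s do
  (rewrite component_residual; under eq_bigr => b _ do rewrite residual_shift).
rewrite derive1_sum_sqr divfK ?pnatr_eq0 //; congr (_ * _).
under eq_bigr => b _ do rewrite mulrCA mulrC.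
by rewrite sum_delta.
Qed.

Lemma grad_objective a l : (0 < I n)%N ->
  grad n (objective X) theta a l
  = \sum_j residual X theta n a j * khatri_rao theta n j l.
Proof.
move=> In_gt0; rewrite mxE; under eq_fun => s do
  (rewrite objective_residual //; under eq_bigr => b _ do rewrite residual_shift).
rewrite derive1_sum_sqr mulVf ?pnatr_eq0 // mul1r.
rewrite -(pair_bigA _ (fun b j =>
  residual X theta n b j * ((b == a)%:R * khatri_rao theta n j l))) /=.
rewrite exchange_big; apply: eq_bigr => j _ /=.
under eq_bigr => b _ do rewrite mulrCA mulrC.
by rewrite sum_delta.
Qed.

Lemma weight_ge0 j : 0 <= weight X theta n j.
Proof. by rewrite mulr_ge0 // fnorm_ge0. Qed.

(** The Frobenius norm of an outer product is the product of the norms of its two vectors. *)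
Lemma weight_sqr j : weight X theta n j ^+ 2
  = \sum_a \sum_l (residual X theta n a j * khatri_rao theta n j l) ^+ 2.
Proof.
rewrite exprMn !fnorm_sqr big_ord1 mulr_suml; apply: eq_bigr => a _.
rewrite big_ord1 mulr_sumr; apply: eq_bigr => l _.
by rewrite !mxE exprMn.
Qed.

Lemma weight_eq0 j : weight X theta n j = 0 -> grad n (component X j) theta = 0.
Proof.
move=> w0; apply/matrixP => a l; rewrite grad_component [RHS]mxE.
have := weight_sqr j; rewrite w0 expr0n /= => /esym/eqP.
rewrite psumr_eq0 => [/allP/(_ a)|b _]; last by apply: sumr_ge0 => k _; exact: sqr_ge0.
rewrite mem_index_enum => /(_ isT); rewrite psumr_eq0 => [/allP/(_ l)|k _]; last exact: sqr_ge0.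
by rewrite mem_index_enum sqrf_eq0 => /(_ isT)/eqP->; rewrite mulr0.
Qed.

Lemma opt_distr_prob : \sum_j weight X theta n j != 0 ->
  prob_distr (opt_distr X theta n).
Proof.
set S := \sum_j _ => S0.
have S_gt0 : 0 < S by rewrite lt0r S0 sumr_ge0 // => j _; exact: weight_ge0.
split=> [j|]; last by rewrite -mulr_suml divff.
rewrite divr_ge0 ?weight_ge0 ?(ltW S_gt0) //= ler_pdivrMr // mul1r.
by rewrite /S (bigD1 j) //= lerDl sumr_ge0 // => j' _; exact: weight_ge0.
Qed.

(** * Expected squared error of the stochastic gradient *)

Variable F : 'I_N -> nat.
Hypotheses (In_gt0 : (0 < I n)%N) (Fn_gt0 : (0 < F n)%N).
Variable q : 'I_(ncols I n) -> R.
Hypotheses (q1 : \sum_j q j = 1) (q_grad : supports_gradients X theta q).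

(** Each matrix entry of the stochastic gradient is a batch mean, so [batch_variance] applies entry
    by entry; summing over the entries gives the norms. *)
Lemma mean_sqr_error :
  \sum_(z : (F n).-tuple 'I_(ncols I n)) (\prod_(s < F n) q (tnth z s))
     * fnorm (stoch_grad X theta q z - grad n (objective X) theta) ^+ 2
  = (F n)%:R^-1 * (\sum_j (q j)^-1 * weight X theta n j ^+ 2)
    - (F n)%:R^-1 * fnorm (grad n (objective X) theta) ^+ 2.
Proof.
(* With no columns [q] could not sum to 1. *)
have J0 : (ncols I n)%:R != 0 :> R.
  rewrite pnatr_eq0; apply: contra_eqN q1 => /eqP J0.
  rewrite big1 ?(eq_sym 0) ?oner_eq0 // => j _.
  by have := ltn_ord j; rewrite {2}J0.
(* One draw's estimate of entry [(a, l)]; the factor [ncols I n] of the component gradient has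
   cancelled. *)
pose e a l j := (q j)^-1 * (residual X theta n a j * khatri_rao theta n j l).
have qe a l : \sum_j q j * e a l j = grad n (objective X) theta a l.
  rewrite grad_objective //; apply: eq_bigr => j _.
  (* An index that is never drawn has zero gradient by [q_grad], so no bias arises. *)
  have [qj0|qj0] := eqVneq (q j) 0; last by rewrite mulVKf.
  have /matrixP/(_ a l) := q_grad qj0.
  rewrite grad_component [RHS]mxE => /eqP; rewrite mulf_eq0 (negPf J0) /= => /eqP->.
  by rewrite qj0 mul0r.
have errE z a l :
    (stoch_grad X theta q z - grad n (objective X) theta) a l
    = (F n)%:R^-1 * (\sum_(s < F n) e a l (tnth z s)) - \sum_j q j * e a l j.
  rewrite qe 2!mxE [X in _ + X]mxE; congr (_ - _).
  rewrite invfM -mulrA summxE mulr_sumr; congr (_ * _); apply: eq_bigr => s _.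
  by rewrite mxE grad_component /e mulrCA mulKf.
under eq_bigr => z _ do rewrite fnorm_sqr mulr_sumr.
rewrite exchange_big /= -mulrBr.
transitivity (\sum_a \sum_l (F n)%:R^-1 *
    (\sum_j q j * e a l j ^+ 2 - grad n (objective X) theta a l ^+ 2)).
  apply: eq_bigr => a _; under eq_bigr => z _ do rewrite mulr_sumr.
  rewrite exchange_big; apply: eq_bigr => l _ /=.
  under eq_bigr => z _ do rewrite errE.
  by rewrite batch_variance // qe.
transitivity (\sum_a (F n)%:R^-1 * (\sum_l \sum_j q j * e a l j ^+ 2
    - \sum_l grad n (objective X) theta a l ^+ 2)).
  by apply: eq_bigr => a _; rewrite -sumrB mulr_sumr.
rewrite -mulr_sumr sumrB fnorm_sqr; congr (_ * (_ - _)).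
transitivity (\sum_j \sum_a \sum_l q j * e a l j ^+ 2).
  by rewrite [RHS]exchange_big; apply: eq_bigr => a _; rewrite exchange_big.
apply: eq_bigr => j _.
rewrite weight_sqr mulr_sumr; apply: eq_bigr => a _.
rewrite mulr_sumr; apply: eq_bigr => l _.
rewrite /e exprMn mulrA; congr (_ * _).
have [->|qj0] := eqVneq (q j) 0; first by rewrite mul0r invr0.
by rewrite expr2 mulVKf.
Qed.

Lemma sqr_sum_weight_le : (forall j, 0 <= q j) ->
  (\sum_j weight X theta n j) ^+ 2 <= \sum_j (q j)^-1 * weight X theta n j ^+ 2.
Proof.
move=> q_ge0; set w := weight X theta n; set S := \sum_j w j.
(* Where [q j] is 0, the term with [(q j)^-1] is 0 by convention; it loses nothing because the
   weight vanishes there. *)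
have w0 j : q j = 0 -> w j = 0.
  move=> /q_grad gj0; apply/eqP; rewrite -sqrf_eq0 weight_sqr.
  rewrite big1 // => a _; rewrite big1 // => l _.
  have /matrixP/(_ a l) := gj0; rewrite grad_component [RHS]mxE => /eqP.
  rewrite mulf_eq0 => /orP[|/eqP->]; last by rewrite expr0n.
  by rewrite pnatr_eq0 => /eqP J0; have := ltn_ord j; rewrite {2}J0.
(* The gap is the variance of [w_j / q_j] under [q]. *)
have : 0 <= \sum_j q j * ((q j)^-1 * w j - S) ^+ 2.
  by apply: sumr_ge0 => j _; rewrite mulr_ge0 // sqr_ge0.
suff -> : \sum_j q j * ((q j)^-1 * w j - S) ^+ 2
    = \sum_j (q j)^-1 * w j ^+ 2 - S ^+ 2 by rewrite subr_ge0.
transitivity (\sum_j ((q j)^-1 * w j ^+ 2 - w j * (S + S) + q j * S ^+ 2)).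
  apply: eq_bigr => j _.
  have [qj0|qj0] := eqVneq (q j) 0; first by rewrite w0 // qj0; ring.
  by field.
by rewrite big_split sumrB -!mulr_suml q1 -/S /=; ring.
Qed.

End Gradients.

(** With total weight [S], each nonzero term becomes [w_j^2 / (w_j / S) = S w_j]. *)
Lemma opt_distr_value (R : realType) (N : nat) (I : 'I_N -> nat) (rk : nat)
    (X : tensor R I) (theta : factors R I rk) (n : 'I_N) q :
  \sum_j q j = 1 -> q =1 opt_distr X theta n ->
  supports_gradients X theta q /\
  \sum_j (q j)^-1 * weight X theta n j ^+ 2 = (\sum_j weight X theta n j) ^+ 2.
Proof.
move=> q1 qE; set S := \sum_j weight X theta n j.
(* If [S] were 0, division by zero would make [opt_distr] identically 0, and it would not sum to
   1. *)
have S0 : S != 0.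
  apply: contra_eqN q1 => /eqP S0; rewrite big1 ?(eq_sym 0) ?oner_eq0 // => j _.
  by rewrite qE /opt_distr -/S S0 invr0 mulr0.
split=> [j|].
  move=> /eqP; rewrite qE mulf_eq0 invr_eq0 (negPf S0) orbF => /eqP.
  exact: weight_eq0.
rewrite expr2 {2}/S mulr_sumr; apply: eq_bigr => j _; rewrite qE /opt_distr -/S.
have [->|wj0] := eqVneq (weight X theta n j) 0; first by rewrite expr0n !mulr0.
by field; rewrite wj0 S0.
Qed.

(** * The sampling process *)

Section Process.
Variables (R : realType) (N : nat) (I : 'I_N -> nat) (rk : nat).
Variables (X : tensor R I) (F : 'I_N -> nat).
Variables (theta0 : factors R I rk) (alpha : nat -> R).
Variables (p : sampling_rule R I rk).
Variables (d : measure_display) (T : measurableType d) (P : probability T R).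
Variables (W : T -> nat -> draw I F) (t : nat).

Lemma eq_iterate (w w' : nat -> draw I F) s :
  (forall r, (r < s)%N -> w r = w' r) ->
  iterate X theta0 alpha p w s = iterate X theta0 alpha p w' s.
Proof.
elim: s => //= s IHs ww'; rewrite IHs => [|r rs]; last exact/ww'/leqW.
by rewrite ww'.
Qed.

(** The information in [past_and_mode], recorded in a finite type so that the results on fibers
    apply. *)
Definition past_mode (omega : T) : {ffun 'I_t -> draw I F} * 'I_N :=
  ([ffun s : 'I_t => W omega s], tag (W omega t)).

Lemma past_mode_eqP omega omega' :
  past_mode omega = past_mode omega' <->
  past W (W omega') t omega /\ tag (W omega t) = tag (W omega' t).
Proof.
split=> [[/ffunP eqW eqt]|[eqW eqt]].
  split=> // s st; have := eqW (Ordinal st); by rewrite !ffunE.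
by rewrite /past_mode eqt; congr (_, _); apply/ffunP => s; rewrite !ffunE eqW.
Qed.

Lemma past_mode_fiberE k : past_mode @^-1` [set k]
  = \bigcap_(s in [set: 'I_t]) [set omega | W omega s = k.1 s]
    `&` [set omega | tag (W omega t) = k.2].
Proof.
case: k => k m; apply/seteqP; split=> [omega /= [<- <-]|omega [/= eqW eqt]].
  by split=> // s _; rewrite /= ffunE.
by rewrite /past_mode eqt; congr (_, _); apply/ffunP => s; rewrite ffunE; apply: eqW.
Qed.

(** Preimages under [past_mode] form a sigma-algebra containing the generators; conversely each
    fiber is a finite intersection of generators. *)
Lemma past_and_modeP A : past_and_mode W t A <->
  exists B : set ({ffun 'I_t -> draw I F} * 'I_N), A = past_mode @^-1` B.
Proof.
split.
  rewrite /past_and_mode; move: A; apply: (@smallest_sub _ _ _ [set A |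
    exists B : set ({ffun 'I_t -> draw I F} * 'I_N), A = past_mode @^-1` B]);
    last first.
    move=> A [[s st [x ->]]|[m ->]]; last by exists [set k | k.2 = m].
    exists [set k : {ffun 'I_t -> draw I F} * 'I_N | k.1 (Ordinal st) = x].
    by apply/seteqP; split=> omega /=; rewrite ffunE.
  split=> [|A [B ->]|As satA].
  - by exists set0; rewrite preimage_set0.
  - by exists (~` B); rewrite setTD preimage_setC.
  (* A union of fibers is the preimage of its own image. *)
  - exists (past_mode @` \bigcup_k As k); apply/seteqP; split=> omega.
      by move=> Aomega; exists omega.
    move=> [omega' [k _ Ak] eqh]; exists k => //.
    by have [B eqB] := satA k; move: Ak; rewrite eqB /= eqh.
(* Here [T] is equipped with the generated sigma-algebra instead of its own. *)
move=> [B ->]; rewrite /past_and_mode; set gens := (X in <<s X>>).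
apply: (@measurable_preimage_fin _ (g_sigma_algebraType gens)) => k.
rewrite past_mode_fiberE; apply: measurableI.
  apply: fin_bigcap_measurable => // s _.
  by apply: sub_sigma_algebra; left; exists s => //; exists (k.1 s).
by apply: sub_sigma_algebra; right; exists k.2.
Qed.

Hypothesis W_process : sampling_process X theta0 alpha p P W.

Let mW s x : measurable [set omega | W omega s = x].
Proof. by have [mW _ _] := W_process. Qed.

Lemma measurable_past_mode k : measurable (past_mode @^-1` [set k]).
Proof.
rewrite past_mode_fiberE; apply: measurableI.
  by apply: fin_bigcap_measurable.
exact: (measurable_preimage_fin [set x | tag x = k.2] (mW t)).
Qed.

Variable err : factors R I rk -> draw I F -> R.
Hypothesis err_ge0 : forall th x, 0 <= err th x.

Let Y omega := err (iterate X theta0 alpha p (W omega) t) (W omega t).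

Let integrable_err : P.-integrable setT (EFin \o Y).
Proof.
pose full omega : {ffun 'I_t.+1 -> draw I F} := [ffun s : 'I_t.+1 => W omega s].
have mfull k : measurable (full @^-1` [set k]).
  have -> : full @^-1` [set k]
      = \bigcap_(s in [set: 'I_t.+1]) [set omega | W omega s = k s].
    apply/seteqP; split=> [omega /= <- s _|omega eqW]; first by rewrite /= ffunE.
    by apply/ffunP => s; rewrite ffunE; apply: eqW.
  by apply: fin_bigcap_measurable.
(* The values of [inord] beyond [t] are harmless: the iterate at [t] reads only the draws before
   [t]. *)
pose y (k : {ffun 'I_t.+1 -> draw I F}) :=
  err (iterate X theta0 alpha p (fun s => k (inord s)) t) (k ord_max).
have -> : Y = fun omega => y (full omega).
  apply/funext => omega; rewrite /Y /y ffunE; congr (err _ _).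
  by apply: eq_iterate => s st; rewrite ffunE inordK // ltnS ltnW.
exact: (integrable_fin P y mfull).
Qed.

(** On a fiber the iterate and the mode are fixed, so the integrand depends on the batch alone,
    whose conditional law is given by [sampling_process]. *)
Lemma integral_past_mode omega :
  let n := tag (W omega t) in
  let th := iterate X theta0 alpha p (W omega) t in
  (\int[P]_(x in past_mode @^-1` [set past_mode omega]) (Y x)%:E
   = (\sum_(z : (F n).-tuple 'I_(ncols I n))
        (\prod_(s < F n) @p t th n (tnth z s)) * err th (Tagged _ z))%:E
     * P (past_mode @^-1` [set past_mode omega]))%E.
Proof.
move=> n th; set fib := past_mode @^-1` _.
have mfib : measurable fib by exact: measurable_past_mode.
have mY : measurable_fun setT Y.
  by apply/measurable_realfun.measurable_EFinP; apply: measurable_int integrable_err.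
have fibE : fib = past W (W omega) t `&` [set x | tag (W x t) = n].
  by apply/seteqP; split=> x; [move/past_mode_eqP|move=> ?; apply/past_mode_eqP].
have [_ _ Wz] := W_process.
rewrite (integral_fibers P (mW t) mfib) //; last by move=> x; exact: err_ge0.
pose g (x : draw I F) := ((err th x)%:E * P (fib `&` [set y | W y t = x]))%E.
transitivity (\sum_x g x)%E.
  apply: eq_bigr => x _; rewrite /g -integral_cst; last exact: measurableI.
  apply: eq_integral => y; rewrite inE => -[/past_mode_eqP[past_y _] /= eqx].
  by rewrite /Y eqx (eq_iterate past_y).
rewrite (eq_bigr (fun x : draw I F => g (Tagged _ (tagged x)))); last by case.
rewrite -(sig_big_dep xpredT (fun _ _ => true)
  (fun m (z : (F m).-tuple 'I_(ncols I m)) => g (Tagged _ z))) /=.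
(* Draws in another mode do not meet the fiber. *)
rewrite (bigD1 n) //= [X in (_ + X)%E]big1 ?adde0; last first.
  move=> m nmn; apply: big1 => z _; rewrite /g.
  suff -> : fib `&` [set y | W y t = Tagged _ z] = set0 by rewrite measure0 mule0.
  apply/seteqP; split=> // y; rewrite fibE => -[[_ /= tag_y] eqz].
  by move: nmn; rewrite -tag_y eqz eqxx.
have Pfib : P fib \is a fin_num by exact: fin_num_measure.
rewrite -[in RHS](fineK Pfib) -EFinM mulr_suml -sumEFin; apply: eq_bigr => z _.
rewrite /g; have -> : fib `&` [set y | W y t = Tagged _ z]
    = past W (W omega) t `&` [set y | W y t = Tagged _ z].
  rewrite fibE; apply/seteqP; split=> y; first by move=> [[? _] ?].
  by move=> [? /= eqz]; do !split => //=; rewrite eqz.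
rewrite Wz -fibE -/th -[in LHS](fineK Pfib) -!EFinM.
by congr EFin; ring.
Qed.

(** On a fiber of positive probability, the mass cancels from [cond_exp_fiber]. *)
Lemma cond_exp_past_mode : {ae P, forall omega,
  let n := tag (W omega t) in
  let th := iterate X theta0 alpha p (W omega) t in
  cond_exp P (past_and_mode W t) Y omega
  = \sum_(z : (F n).-tuple 'I_(ncols I n))
      (\prod_(s < F n) @p t th n (tnth z s)) * err th (Tagged _ z)}.
Proof.
have := ae_fiber_neq0 P measurable_past_mode.
apply: filterS => omega P_neq0 n th.
have Y_ge0 x : 0 <= Y x by exact: err_ge0.
have := cond_exp_fiber measurable_past_mode past_and_modeP omega integrable_err Y_ge0.
rewrite integral_past_mode -/n -/th.
have Pfin : P (past_mode @^-1` [set past_mode omega]) \is a fin_num.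
  by apply: fin_num_measure; exact: measurable_past_mode.
rewrite -(fineK Pfin) -!EFinM => -[]; apply: mulIf.
by rewrite fine_eq0.
Qed.

End Process.

(** Minimality is expressed by letting the rule [p] vary: [min_value] involves [p] only through the
    iterate, which is fixed before iteration [t]. The first conjunct makes [opt_distr] an admissible
    choice whenever its denominator is nonzero. *)
Theorem theorem11 (R : realType) (N : nat) (I : 'I_N -> nat) (rk : nat)
    (X : tensor R I) (F : 'I_N -> nat)
    (theta0 : factors R I rk) (alpha : nat -> R)
    (p : sampling_rule R I rk)
    (d : measure_display) (T : measurableType d) (P : probability T R)
    (W : T -> nat -> draw I F) (t : nat)
    (N_gt0 : (0 < N)%N) (I_gt0 : forall k, (0 < I k)%N) (rk_gt0 : (0 < rk)%N)
    (F_gt0 : forall n, (0 < F n)%N)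
    (p_distr : forall s theta n, prob_distr (p s theta n))
    (W_process : sampling_process X theta0 alpha p P W) :
  let theta omega := iterate X theta0 alpha p (W omega) t in
  let xi omega := tag (W omega t) in
  let zeta omega := tagged (W omega t) in
  let mean_sq_error :=
    cond_exp P (past_and_mode W t)
      (fun omega =>
         fnorm (stoch_grad X (theta omega)
                  (p t (theta omega) (xi omega)) (zeta omega)
                - grad (xi omega) (objective X) (theta omega)) ^+ 2) in
  let min_value omega :=
    ((F (xi omega))%:R)^-1 * (\sum_j weight X (theta omega) (xi omega) j) ^+ 2
    - ((F (xi omega))%:R)^-1
      * fnorm (grad (xi omega) (objective X) (theta omega)) ^+ 2 in
  (forall (th : factors R I rk) n, \sum_j weight X th n j != 0 ->
     prob_distr (opt_distr X th n)) /\
  {ae P, forall omega,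
     let q := p t (theta omega) (xi omega) in
     (supports_gradients X (theta omega) q ->
        min_value omega <= mean_sq_error omega) /\
     (q =1 opt_distr X (theta omega) (xi omega) ->
        supports_gradients X (theta omega) q /\
        mean_sq_error omega = min_value omega)}.
Proof.
move=> theta xi zeta mean_sq_error min_value; split.
  by move=> th n; exact: opt_distr_prob.
(* The mode is read off the draw, so that the error is a function of the iterate and the draw. *)
pose err (th : factors R I rk) (x : draw I F) :=
  fnorm (stoch_grad X th (p t th (tag x)) (tagged x)
         - grad (tag x) (objective X) th) ^+ 2.
have err_ge0 th x : 0 <= err th x by exact: sqr_ge0.
have := cond_exp_past_mode t W_process err_ge0.
apply: filterS => omega mseE; set q := p t (theta omega) (xi omega).
have [q01 q1] := p_distr t (theta omega) (xi omega).
have mse_val : supports_gradients X (theta omega) q ->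
    mean_sq_error omega
    = (F (xi omega))%:R^-1
        * (\sum_j (q j)^-1 * weight X (theta omega) (xi omega) j ^+ 2)
      - (F (xi omega))%:R^-1
        * fnorm (grad (xi omega) (objective X) (theta omega)) ^+ 2.
  move=> q_grad; rewrite -mean_sqr_error //; exact: mseE.
split=> [q_grad|qE].
  rewrite mse_val // lerD2r ler_pM2l ?invr_gt0 ?ltr0n //.
  by apply: sqr_sum_weight_le => // j; have /andP[] := q01 j.
have [q_grad q_val] := opt_distr_value q1 qE.
by split=> //; rewrite mse_val // q_val.
Qed.
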